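(* The class $\mathcal{P}_{\mathcal H}(\beta)=\mathcal{P}_{\mathcal H}(\beta,L)$ of Hölder smooth probability densities on $[0,1]^d$ has metric entropy satisfying $$H(\mathcal{P}_{\mathcal H}(\beta),\delta)\le c_{\beta,d,L}\,\delta^{-\frac{d}{\beta}}\log\frac1\delta ,$$ where $c_{\beta,d,L}$ is a constant depending on $\beta,d,L$.
   Context: $d\ge1$ is an integer, $\beta>0$ is real, and $L>0$ is fixed. For a multi-index $s\in\mathbb{Z}_{\ge0}^d$ write $|s|=s_1+\dots+s_d$ and $D^s=\partial^{|s|}/\partial x_1^{s_1}\cdots\partial x_d^{s_d}$. $\lfloor\beta\rfloor$ denotes the maximal integer strictly less than $\beta$. $\mathcal{H}(\beta,L)$ is the space of functions $f:\mathbb{R}^d\to\mathbb{R}$ that are supported on the cube $[0,1]^d$, are $\lfloor\beta\rfloor$ times differentiable, and satisfy $|D^sf(x)-D^sf(y)|\le L|x-y|_2^{\beta-\lfloor\beta\rfloor}$ for all $x,y\in\mathbb{R}^d$ and all multi-indices $s$ with $|s|=\lfloor\beta\rfloor$, where $|\cdot|_2$ is the Euclidean norm. $\mathcal{P}_{\mathcal H}(\beta,L)$ is the set of probability density functions contained in $\mathcal{H}(\beta,L)$. For a function class $\mathcal F$, $N(\mathcal F,\delta)$ denotes the minimal number of cubes of side-length $\delta$ (that is, balls for the supremum norm) that cover $\mathcal F$, and $H(\mathcal F,\delta)=\log N(\mathcal F,\delta)$ is the metric entropy.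
   Formalization: The bound is stated for 0 < δ ≤ 1/2; for arbitrary δ it fails, since for δ > 1 the right side is negative while the entropy of a nonempty class is nonnegative, and as δ → 1 from below the right side tends to 0. *)

(* Defs.v *)
From HB Require Import structures.
From mathcomp Require Import all_boot all_order all_algebra.
From mathcomp Require Import all_classical all_reals all_analysis.

Set Implicit Arguments.
Unset Strict Implicit.
Unset Printing Implicit Defensive.

Import Order.TTheory GRing.Theory Num.Theory.
Import numFieldNormedType.Exports.

Local Open Scope classical_set_scope.
Local Open Scope ring_scope.

Section lebesgue_tuple.
Context {R : realType}.
Local Notation TR := (measurableTypeR R).

Definition tuple_cons n (p : TR * n.-tuple TR) : n.+1.-tuple TR :=
  [tuple of p.1 :: p.2].

Lemma measurable_tuple_cons n :
  measurable_fun [set: TR * n.-tuple TR] (@tuple_cons n).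
Proof. exact: measurable_cons. Qed.

(* Lebesgue measure on R^n, as an iterated product. *)
Fixpoint lebesgue_tuple (n : nat) : set (n.-tuple TR) -> \bar R :=
  match n with
  | 0 => dirac [tuple]
  | m.+1 => pushforward (lebesgue_measure \x @lebesgue_tuple m)%E (@tuple_cons m)
  end.

Section step.
Variables (n : nat) (mu : {sigma_finite_measure set (n.-tuple TR) -> \bar R}).

Definition lebesgue_tuple_step :=
  pushforward (lebesgue_measure \x mu)%E (@tuple_cons n).

Let nu := lebesgue_tuple_step.

Let nu0 : nu set0 = 0%E.
Proof. by rewrite /nu /lebesgue_tuple_step /pushforward preimage_set0 measure0. Qed.

Let nu_ge0 A : (0 <= nu A)%E.
Proof. by rewrite /nu /lebesgue_tuple_step /pushforward measure_ge0. Qed.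

Let measurable_pre A : measurable A -> measurable (@tuple_cons n @^-1` A).
Proof.
by move=> mA; rewrite -[X in measurable X]setTI; exact: measurable_tuple_cons.
Qed.

Let nu_sigma_additive : semi_sigma_additive nu.
Proof.
move=> F mF tF mUF; rewrite /nu /lebesgue_tuple_step /pushforward preimage_bigcup.
apply: measure_semi_sigma_additive.
- by move=> k; exact: measurable_pre.
- apply/trivIsetP => /= i j _ _ ij; rewrite -preimage_setI.
  by move/trivIsetP : tF => /(_ _ _ _ _ ij) ->//; rewrite preimage_set0.
- by rewrite -preimage_bigcup; exact: measurable_pre.
Qed.

HB.instance Definition _ :=
  isMeasure.Build _ _ _ lebesgue_tuple_step nu0 nu_ge0 nu_sigma_additive.

Let nu_sigma_finite : sigma_finite setT lebesgue_tuple_step.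
Proof.
have /sigma_finiteP[F [FT ndF Foo]] := sigma_finiteT (@lebesgue_measure R).
have /sigma_finiteP[G [GT ndG Goo]] := sigma_finiteT mu.
exists (fun k => [set t | F k (thead t) /\ G k [tuple of behead t]]).
  apply/esym; rewrite -subTset => t _.
  have [i _ Fi] : (\bigcup_i F i) (thead t) by rewrite -FT.
  have [j _ Gj] : (\bigcup_i G i) [tuple of behead t] by rewrite -GT.
  exists (maxn i j) => //; split.
    by move: (thead t) Fi; exact/subsetPset/ndF/leq_maxl.
  by move: [tuple of behead t] Gj; exact/subsetPset/ndG/leq_maxr.
move=> k; have [mF Fk] := Foo k; have [mG Gk] := Goo k; split.
  apply: measurableI; rewrite -[X in measurable X]setTI.
    exact: measurable_tnth.
  exact: measurable_behead.
rewrite /lebesgue_tuple_step /pushforward (_ : _ @^-1` _ = F k `*` G k).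
  by rewrite product_measure1E// lte_mul_pinfty// ge0_fin_numE.
apply/seteqP; split=> -[x t] /=; rewrite /thead tnth0;
  by rewrite (_ : [tuple of _] = t)//; exact/val_inj.
Qed.

HB.instance Definition _ :=
  Measure_isSigmaFinite.Build _ _ _ lebesgue_tuple_step nu_sigma_finite.

End step.

Lemma lebesgue_tupleP n :
  exists mu : {sigma_finite_measure set (n.-tuple TR) -> \bar R},
    @lebesgue_tuple n = mu :> (set _ -> \bar R).
Proof.
elim: n => [|n [mu muE]]; first by exists (@dirac _ (0.-tuple TR) [tuple] R).
by exists (lebesgue_tuple_step mu); rewrite /= muE.
Qed.

Section instances.
Variable n : nat.

Let leb0 : @lebesgue_tuple n set0 = 0%E.
Proof. by have [mu ->] := lebesgue_tupleP n; rewrite measure0. Qed.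

Let leb_ge0 A : (0 <= @lebesgue_tuple n A)%E.
Proof. by have [mu ->] := lebesgue_tupleP n; rewrite measure_ge0. Qed.

Let leb_sigma_additive : semi_sigma_additive (@lebesgue_tuple n).
Proof.
by have [mu ->] := lebesgue_tupleP n; exact: measure_semi_sigma_additive.
Qed.

HB.instance Definition _ := isMeasure.Build _ _ _ (@lebesgue_tuple n)
  leb0 leb_ge0 leb_sigma_additive.

Let leb_sigma_finite : sigma_finite setT (@lebesgue_tuple n).
Proof. by have [mu ->] := lebesgue_tupleP n; exact: sigma_finiteT. Qed.

HB.instance Definition _ := Measure_isSigmaFinite.Build _ _ _
  (@lebesgue_tuple n) leb_sigma_finite.

End instances.

Lemma lebesgue_tuple_box n (A : 'I_n -> set TR) :
  (forall i, measurable (A i)) ->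
  lebesgue_tuple [set t : n.-tuple TR | forall i, A i (tnth t i)] =
  (\prod_(i < n) lebesgue_measure (A i))%E.
Proof.
elim: n A => [|n IH] A mA /=.
  by rewrite big_ord0 diracE mem_set//= => -[].
rewrite /pushforward big_ord_recl.
rewrite (_ : _ @^-1` _ =
  A ord0 `*` [set t : n.-tuple TR | forall i, A (lift ord0 i) (tnth t i)]).
  rewrite product_measure1E//.
    by congr (_ * _)%E; rewrite -IH.
  rewrite (_ : [set t | _] = \bigcap_(i in [set: 'I_n])
      ((fun t : n.-tuple TR => tnth t i) @^-1` A (lift ord0 i))).
    apply: fin_bigcap_measurable => // i _.
    by rewrite -[X in measurable X]setTI; exact: measurable_tnth.
  by apply/seteqP; split=> t /= h i; [move=> _; exact: h|exact: h].
apply/seteqP; split=> -[x t] /=.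
  move=> h; split; first by have := h ord0; rewrite tnth0.
  by move=> i; have := h (lift ord0 i); rewrite tnthS.
move=> [Ax At] i; case: (unliftP ord0 i) => [j|] ->; first by rewrite tnthS.
by rewrite tnth0.
Qed.

End lebesgue_tuple.

Definition row_of_tuple {R : realType} d (t : d.-tuple (measurableTypeR R)) :
  'rV[R]_d := \row_i tnth t i.

Section holder.
Context {R : realType}.

(* The largest integer STRICTLY less than b, for b > 0: it is n when b = n.+1. *)
Definition strict_floor (b : R) : nat := `|(Num.ceil b - 1)%R|%N.

Lemma strict_floorP (b : R) (m : int) :
  0 < b -> (m <= (strict_floor b)%:Z) = (m%:~R < b).
Proof.
move=> b0; rewrite /strict_floor gez0_abs.
  by rewrite -ceil_gt_int lerBrDr lezD1.
by rewrite subr_ge0 -gtz0_ge1 ceil_gt0.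
Qed.

Definition euclidean_norm d (x : 'rV[R]_d) : R :=
  Num.sqrt (\sum_(i < d) x 0 i ^+ 2).

Definition partial d (i : 'I_d) (f : 'rV[R]_d -> R) : 'rV[R]_d -> R :=
  fun x => 'D_(delta_mx 0 i) f x.

(* D^s, with the derivatives in the last coordinate taken first. *)
Definition multi_derivative d (s : 'I_d -> nat) (f : 'rV[R]_d -> R) :
    'rV[R]_d -> R :=
  foldr (fun i g => iter (s i) (partial i) g) f (enum 'I_d).

(* k-fold Frechet differentiability on R^d: the derivative of f is given by its
   partial derivatives, so it is k times differentiable iff they all are. *)
Fixpoint times_differentiable d (k : nat) (f : 'rV[R]_d -> R) : Prop :=
  match k with
  | 0 => True
  | k'.+1 => (forall x, differentiable f x) /\
             forall i, times_differentiable k' (partial i f)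
  end.

Definition unit_cube d : set 'rV[R]_d :=
  [set x | forall i, 0 <= x 0 i <= 1].

Definition holder_class d (beta L : R) : set ('rV[R]_d -> R) :=
  [set f | [/\ forall x, ~ unit_cube x -> f x = 0,
     times_differentiable (strict_floor beta) f &
     forall s : 'I_d -> nat, (\sum_(i < d) s i)%N = strict_floor beta ->
     forall x y, `|multi_derivative s f x - multi_derivative s f y| <=
       L * euclidean_norm (x - y) `^ (beta - (strict_floor beta)%:R)]].

Definition probability_density d : set ('rV[R]_d -> R) :=
  [set f : 'rV[R]_d -> R | [/\ measurable_fun setT (f \o @row_of_tuple R d),
     forall x, 0 <= f x &
     (\int[@lebesgue_tuple R d]_t (f (row_of_tuple t))%:E = 1)%E]].

Definition holder_density d (beta L : R) : set ('rV[R]_d -> R) :=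
  @probability_density d `&` @holder_class d beta L.

(* A cube of side-length delta is a closed sup-norm ball of RADIUS delta / 2. *)
Definition function_cube T (delta : R) (c : T -> R) : set (T -> R) :=
  [set g | forall x, `|g x - c x| <= delta / 2].

(* +oo when no finite number of cubes covers F *)
Definition covering_number T (F : set (T -> R)) (delta : R) : \bar R :=
  ereal_inf [set (n%:R)%:E | n in [set n : nat | exists c : 'I_n -> T -> R,
    F `<=` \bigcup_i function_cube delta (c i)]].

Definition metric_entropy T (F : set (T -> R)) (delta : R) : \bar R :=
  lne (covering_number F delta).

End holder.

(* Main.v *)
Require Import Defs.
From HB Require Import structures.
From mathcomp Require Import all_boot all_order all_algebra.
From mathcomp Require Import all_classical all_reals all_analysis.
From mathcomp Require Import ring lra.

Import Order.TTheory GRing.Theory Num.Theory.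
Import numFieldNormedType.Exports.

Local Open Scope classical_set_scope.
Local Open Scope ring_scope.

(** The densities in question form a subset of the Hoelder class, so it is enough
    to code each function of that class by an element of a finite type in such a
    way that two functions with the same code are within [delta / 2] of each other
    ([covering_number_le_card]).  The code of [f] consists of its values at the
    points of the lattice of mesh [1 / M] in the unit cube, rounded to precision
    [eta].

    Two functions with the same code differ by a function [h] that is at most
    [eta] on the whole lattice, outside the cube because it vanishes there.
    Smoothness turns this into a bound everywhere: on a line parallel to an axis,
    a function that is at most [eta] somewhere in every interval of length [eps],
    and whose [k]-th derivative is [alpha]-Hoelder, is
    [O(eta + eps ^ (k + alpha))] ([small_of_relatively_dense_small]).  Applying
    this to one coordinate after another ([small_of_lattice_small]) frees the
    coordinates from the lattice, so only pure derivatives along the axes enter.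
    The same one-dimensional estimate, with [eta = 0] and [eps = 2], bounds all
    functions of the class by a common [B], because they vanish outside the cube.

    With [eta] and [M ^ (- beta)] both of order [delta], there are
    [O(delta ^ (- d / beta))] lattice points and [O(1 / delta)] possible rounded
    values at each of them; the logarithm of the number of codes is the product
    of the first number with the logarithm of the second. *)

(** * Interpolation on a line *)

(** Induction on [k].  By the mean value theorem between small points of
    [[z, z + eps]] and [[z + 2 eps, z + 3 eps]], the derivative is at most
    [2 eta / eps] somewhere in every interval of length [3 eps]; the induction
    hypothesis bounds the derivative everywhere, and one more use of the mean
    value theorem from a nearby small point bounds the function. *)
Lemma small_of_relatively_dense_small (R : realType) (alpha : R) (k : nat) :
  0 <= alpha ->
  exists2 A : R, 1 <= A & forall (L eps eta : R) (phi : nat -> R -> R),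
    0 <= L -> 0 < eps -> 0 <= eta ->
    (forall m, (m < k)%N -> forall t : R, is_derive t 1 (phi m) (phi m.+1 t)) ->
    (forall s t, `|phi k s - phi k t| <= L * `|s - t| `^ alpha) ->
    (forall y, exists2 xi, y <= xi <= y + eps & `|phi 0%N xi| <= eta) ->
    forall x, `|phi 0%N x| <= A * (eta + L * (eps ^+ k * eps `^ alpha)).
Proof.
move=> alpha0; elim: k => [|k [A A1 IH]].
  exists 1 => // L eps eta phi L0 eps0 eta0 _ holder dense x.
  have [xi /andP[x_le le_x] small] := dense x.
  rewrite !mul1r.
  have -> : phi 0%N x = phi 0%N xi + (phi 0%N x - phi 0%N xi).
    by rewrite addrC subrK.
  apply: (le_trans (ler_normD _ _)); apply: lerD => //.
  apply: (le_trans (holder _ _)); apply: ler_wpM2l => //.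
  apply: ge0_ler_powR; rewrite // ?nnegrE // ?(ltW eps0) //.
  by rewrite ler_norml; apply/andP; split; lra.
have A0 : 0 <= A by lra.
set a3 : R := 3 ^+ k * 3 `^ alpha.
have a3_ge0 : 0 <= a3 by rewrite mulr_ge0 ?exprn_ge0 ?powR_ge0.
exists (1 + A * (2 + a3)).
  by rewrite lerDl mulr_ge0 //; lra.
move=> L eps eta phi L0 eps0 eta0 derphi holder dense x.
have mvt a b : a <= b -> exists2 xi, a <= xi <= b &
    phi 0%N b - phi 0%N a = phi 1%N xi * (b - a).
  move=> ab; have [|xi] := @MVT_segment _ (phi 0%N) (phi 1%N) _ _ ab (fun t _ => derphi 0%N isT t).
    by apply: derivable_within_continuous => t _; case: (derphi 0%N isT t).
  by rewrite in_itv /= => xiab ->; exists xi.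
(* The gap of at least [eps] between the two small points is what bounds the
   difference quotient. *)
have bound1 y : `|phi 1%N y| <=
    A * (2 * eta / eps + L * ((3 * eps) ^+ k * (3 * eps) `^ alpha)).
  apply: (IH _ _ _ (fun m => phi m.+1)) => //.
  - by rewrite mulr_gt0.
  - by rewrite divr_ge0 ?mulr_ge0 // ltW.
  - by move=> m mk t; exact: derphi.
  move=> z.
  have [xi1 /andP[z1 z2] small1] := dense z.
  have [xi2 /andP[z3 z4] small2] := dense (z + 2 * eps).
  have [|xi /andP[xi_ge xi_le] dphi] := mvt xi1 xi2; first lra.
  exists xi; first by apply/andP; split; lra.
  rewrite ler_pdivlMr //.
  apply: (@le_trans _ _ `|phi 1%N xi * (xi2 - xi1)|).
    rewrite normrM; apply: ler_wpM2l => //.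
    by rewrite ger0_norm; lra.
  rewrite -dphi; apply: (le_trans (ler_normB _ _)); lra.
have [x0 /andP[x0_ge x0_le] small] := dense x.
have [xi _ dphi] := mvt _ _ x0_ge.
have -> : phi 0%N x = phi 0%N x0 - phi 1%N xi * (x0 - x) by rewrite -dphi; ring.
apply: (le_trans (ler_normB _ _)).
set B := A * (2 * eta / eps + L * ((3 * eps) ^+ k * (3 * eps) `^ alpha)) in bound1.
have slope : `|phi 1%N xi * (x0 - x)| <= B * eps.
  by rewrite normrM; apply: ler_pM => //; rewrite ger0_norm; lra.
have BE : B * eps = A * (2 * eta + a3 * (L * (eps ^+ k.+1 * eps `^ alpha))).
  by rewrite /B exprMn powRM ?ltW // exprS /a3; field; rewrite gt_eqF.
have rem_ge0 : 0 <= L * (eps ^+ k.+1 * eps `^ alpha).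
  by rewrite !mulr_ge0 ?exprn_ge0 ?powR_ge0 // ltW.
apply: (le_trans (lerD small slope)); rewrite BE.
move: (L * _) rem_ge0 => r r0.
have : 0 <= r + A * (2 * r) + A * (a3 * eta).
  by rewrite !addr_ge0 // !mulr_ge0.
nra.
Qed.

(** * Restriction of the Hoelder class to lines parallel to the axes *)

(** The restriction of [h] to each line parallel to an axis comes with its
    successive derivatives [phi 1], ..., [phi k].  Carrying them as witnesses
    makes the notion stable under differences without any linearity of the
    partial derivative operators. *)
Definition holder_along_axes {R : realType} {d : nat} (k : nat) (alpha L : R)
    (h : 'rV[R]_d -> R) :=
  forall (i : 'I_d) (x : 'rV[R]_d), exists2 phi : nat -> R -> R,
    phi 0%N = (fun t => h (x + t *: delta_mx 0 i)) &
    (forall m, (m < k)%N -> forall t : R, is_derive t 1 (phi m) (phi m.+1 t)) /\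
    (forall s t, `|phi k s - phi k t| <= L * `|s - t| `^ alpha).

Lemma holder_along_axesB (R : realType) d k (alpha L M : R)
    (f g : 'rV[R]_d -> R) :
  holder_along_axes k alpha L f -> holder_along_axes k alpha M g ->
  holder_along_axes k alpha (L + M) (fun x => f x - g x).
Proof.
move=> hf hg i x.
have [phi phi0 [dphi hphi]] := hf i x; have [psi psi0 [dpsi hpsi]] := hg i x.
exists (fun m t => phi m t - psi m t); first by rewrite phi0 psi0.
split=> [m mk t|s t].
  by have := dphi m mk t; have := dpsi m mk t => ? ?; exact: is_deriveB.
rewrite mulrDl (_ : _ - _ = (phi k s - phi k t) - (psi k s - psi k t)).
  by apply: (le_trans (ler_normB _ _)); exact: lerD.
ring.
Qed.

Lemma times_differentiable_iter (R : realType) d (i : 'I_d) k m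
    (f : 'rV[R]_d -> R) :
  times_differentiable k f -> (m < k)%N ->
  forall x, differentiable (iter m (partial i) f) x.
Proof.
elim: k m f => // k IH [|m] f [df dpf] mk; first exact: df.
by rewrite iterSr; exact: IH (dpf i) mk.
Qed.

(** The difference quotients of the restriction to the line are literally those
    of the directional derivative. *)
Lemma is_derive_along_axis (R : realType) d (i : 'I_d) (g : 'rV[R]_d -> R)
    (x : 'rV[R]_d) (t : R) :
  differentiable g (x + t *: delta_mx 0 i) ->
  is_derive t 1 (fun s => g (x + s *: delta_mx 0 i))
    (partial i g (x + t *: delta_mx 0 i)).
Proof.
move=> dg; have := @diff_derivable _ _ _ _ _ (delta_mx 0 i) dg.
set e := delta_mx 0 i; set a := x + t *: e.
have quotientE : (fun h : R => h^-1 *: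
      (((fun s => g (x + s *: e)) \o shift t) (h *: (1 : R)) - g (x + t *: e))) =
    (fun h : R => h^-1 *: ((g \o shift a) (h *: e) - g a)).
  apply/funext => h /=; rewrite /a; congr (_ *: (g _ - _)).
  by rewrite /shift /= scaler1 scalerDl addrCA.
move=> dga; split; first by rewrite /derivable quotientE.
by rewrite /partial /derive quotientE.
Qed.

(** For a multi-index concentrated at [i], the operators of the other coordinates
    are iterated zero times. *)
Lemma multi_derivative_pure (R : realType) d (i : 'I_d) k
    (f : 'rV[R]_d -> R) :
  multi_derivative (fun j => if j == i then k else 0%N) f =
  iter k (partial i) f.
Proof.
rewrite /multi_derivative; have := enum_uniq 'I_d; have := mem_enum 'I_d i.
rewrite inE; elim: (enum 'I_d) => // j r IH.
rewrite in_cons /= => /predU1P[<-|ir] /andP[jr ur].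
  rewrite eqxx; congr (iter _ _ _).
  elim: r jr {IH ur} => // l r IH.
  rewrite in_cons negb_or /= => /andP[il ir].
  by rewrite eq_sym (negbTE il) IH.
by rewrite (_ : (j == i) = false) ?IH //; apply: contraNF jr => /eqP ->.
Qed.

Lemma euclidean_norm_axis (R : realType) d (i : 'I_d) (t : R) :
  euclidean_norm (t *: delta_mx 0 i) = `|t|.
Proof.
rewrite /euclidean_norm (bigD1 i) //= big1 => [|j ji].
  by rewrite !mxE !eqxx mulr1 addr0 sqrtr_sqr.
by rewrite !mxE (negbTE ji) andbF mulr0 expr0n.
Qed.

Lemma holder_class_along_axes (R : realType) d (beta L : R)
    (f : 'rV[R]_d -> R) :
  holder_class beta L f ->
  holder_along_axes (strict_floor beta) (beta - (strict_floor beta)%:R) L f.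
Proof.
move=> [_ df hf] i x.
exists (fun m t => iter m (partial i) f (x + t *: delta_mx 0 i)) => //.
split=> [m mk t|s t].
  by apply: is_derive_along_axis; exact: times_differentiable_iter df mk _.
have sumE : (\sum_(j < d) (if j == i then strict_floor beta else 0))%N =
    strict_floor beta.
  by rewrite -big_mkcond big_pred1_eq.
have := hf _ sumE (x + s *: delta_mx 0 i) (x + t *: delta_mx 0 i).
by rewrite multi_derivative_pure opprD addrACA subrr add0r -scalerBl euclidean_norm_axis.
Qed.

(** * From the lattice to the whole space *)

Definition on_lattice {R : realType} (M : nat) (r : R) :=
  exists m : int, r = m%:~R / M%:R.

Lemma lattice_relatively_dense (R : realType) (M : nat) (y : R) :
  (0 < M)%N -> exists2 r, on_lattice M r & y <= r <= y + M%:R^-1.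
Proof.
move=> M0; have MR0 : 0 < M%:R :> R by rewrite ltr0n.
exists ((Num.ceil (y * M%:R))%:~R / M%:R); first by eexists.
have /andP[lo hi] := ceil_itv (y * M%:R).
rewrite ler_pdivlMr // hi /= ler_pdivrMr // mulrDl mulVf ?gt_eqF //.
by rewrite -lerBlDr ltW //; rewrite intrB in lo.
Qed.

(** The coordinates are freed one at a time: if the bound holds whenever the
    coordinates of index at least [j] are on the lattice, then on the line through
    such a point in direction [j] the bound holds in every interval of length
    [1 / M], hence, with a constant multiplied by at most [2 A], on the whole
    line. *)
Lemma small_of_lattice_small (R : realType) (d k : nat) (alpha : R) :
  0 <= alpha ->
  exists2 C : R, 1 <= C & forall (L eta : R) (M : nat) (h : 'rV[R]_d -> R),
    0 <= L -> 0 <= eta -> (0 < M)%N -> holder_along_axes k alpha L h ->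
    (forall x : 'rV[R]_d, (forall i, on_lattice M (x 0 i)) -> `|h x| <= eta) ->
    forall x, `|h x| <= C * (eta + L * (M%:R^-1 ^+ k * M%:R^-1 `^ alpha)).
Proof.
move=> alpha0.
have [A A1 line_bound] := small_of_relatively_dense_small R alpha k alpha0.
have A2 : 1 <= 2 * A by lra.
exists ((2 * A) ^+ d); first exact: exprn_ege1.
move=> L eta M h L0 eta0 M0 holder lattice_small.
have eps0 : 0 < M%:R^-1 :> R by rewrite invr_gt0 ltr0n.
set r := L * _.
have r0 : 0 <= r by rewrite !mulr_ge0 ?exprn_ge0 ?powR_ge0 // ltW.
have claim j : (j <= d)%N -> forall x : 'rV[R]_d,
    (forall i : 'I_d, (j <= i)%N -> on_lattice M (x 0 i)) ->
    `|h x| <= (2 * A) ^+ j * (eta + r).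
  elim: j => [|j IH] jd x x_lat.
    rewrite mul1r (le_trans (lattice_small _ _)) ?lerDl // => i.
    exact: x_lat.
  pose i := Ordinal jd.
  have [phi phi0 [dphi hphi]] := holder i x.
  have -> : h x = phi 0%N 0 by rewrite phi0 scale0r addr0.
  set E := (2 * A) ^+ j * (eta + r).
  have rE : r <= E.
    have : 1 <= (2 * A) ^+ j by exact: exprn_ege1.
    rewrite /E; nra.
  have E0 : 0 <= E by exact: le_trans r0 rE.
  apply: (@le_trans _ _ (A * (E + r))); last first.
    by rewrite exprS -mulrA -/E; nra.
  apply: (line_bound _ _ _ phi) => // y.
  have [s s_lat /andP[s_ge s_le]] := lattice_relatively_dense R M (x 0 i + y) M0.
  exists (s - x 0 i); first by apply/andP; split; lra.
  rewrite phi0; apply: IH => [|l jl]; first exact: ltnW.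
  rewrite !mxE /=; have [->|li] := eqVneq l i.
    by rewrite mulr1 addrC subrK.
  rewrite mulr0 addr0; apply: x_lat.
  by rewrite ltn_neqAle jl andbT; apply: contra li => /eqP jl'; apply/eqP/val_inj.
by move=> x; apply: claim (leqnn d) _ _ => i; rewrite leqNgt ltn_ord.
Qed.

Lemma holder_exponent_ge0 (R : realType) (beta : R) :
  0 < beta -> 0 <= beta - (strict_floor beta)%:R.
Proof.
move=> beta0; have := strict_floorP (strict_floor beta) beta0.
by rewrite lexx => /esym/ltW; rewrite subr_ge0.
Qed.

(** On a line parallel to the first axis, every interval of length [2] contains
    a point at which the function vanishes, because its support has width at most
    [1] there. *)
Lemma holder_class_bounded (R : realType) (d : nat) (beta L : R) :
  (1 <= d)%N -> 0 < beta -> 0 <= L ->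
  exists2 B : R, 0 <= B &
    forall f : 'rV[R]_d -> R, holder_class beta L f -> forall x, `|f x| <= B.
Proof.
move=> d1 beta0 L0; pose i := Ordinal d1.
set k := strict_floor beta; set alpha := beta - k%:R.
have [A A1 line_bound] := small_of_relatively_dense_small R alpha k
  (holder_exponent_ge0 _ _ beta0).
exists (A * (0 + L * (2 ^+ k * 2 `^ alpha))).
  by rewrite add0r !mulr_ge0 ?exprn_ge0 ?powR_ge0 //; lra.
move=> f Hf x.
have [phi phi0 [dphi hphi]] := holder_class_along_axes _ _ _ _ _ Hf i x.
have -> : f x = phi 0%N 0 by rewrite phi0 scale0r addr0.
apply: line_bound => // y.
have vanish s : ~~ (0 <= x 0 i + s <= 1) -> `|phi 0%N s| <= 0.
  move=> out; have [f0 _ _] := Hf; rewrite phi0 f0 ?normr0 // => /(_ i).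
  by rewrite !mxE !eqxx mulr1; apply/negP.
have [neg|nonneg] := ltP (x 0 i + y) 0.
  by exists y; [apply/andP; split; lra | apply: vanish; apply/negP => /andP[]; lra].
by exists (y + 2); [apply/andP; split; lra | apply: vanish; apply/negP => /andP[]; lra].
Qed.

(** * Coding and counting *)

(** The cubes are centered at one representative of each code that occurs; a code
    that does not occur gets the default center [0]. *)
Lemma covering_number_le_card (R : realType) (X : Type) (T : finType)
    (F : set (X -> R)) (delta : R) (code : (X -> R) -> T) :
  (forall f g, F f -> F g -> code f = code g ->
    forall x, `|f x - g x| <= delta / 2) ->
  (covering_number F delta <= (#|T|%:R)%:E)%E.
Proof.
move=> code_sep; apply: ereal_inf_lbound; exists #|T| => //.
pose rep t : X -> R := xget (fun=> 0) [set f | F f /\ code f = t].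
exists (fun n => rep (enum_val n)) => f Ff.
exists (enum_rank (code f)) => //; rewrite enum_rankK => x.
have [|Fg gE] := @xgetPex _ (fun=> 0) [set g | F g /\ code g = code f].
  by exists f.
exact: code_sep.
Qed.

(** Values in [[- B, B]] are shifted to be nonnegative before rounding down, so
    the levels run from [0] to the integer part of [2 B / eta] and [inord] never
    falls back on its default. *)
Lemma quantization_error (R : realType) (B eta u v : R) :
  0 < eta -> `|u| <= B -> `|v| <= B ->
  inord (Num.truncn ((u + B) / eta)) =
    inord (Num.truncn ((v + B) / eta)) :> 'I_(Num.truncn (2 * B / eta)).+1 ->
  `|u - v| <= eta.
Proof.
move=> eta0.
have level w : `|w| <= B -> 0 <= (w + B) / eta /\
    (Num.truncn ((w + B) / eta) < (Num.truncn (2 * B / eta)).+1)%N.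
  rewrite ler_norml => /andP[wlo whi].
  split; first by rewrite divr_ge0 //; lra.
  by rewrite ltnS le_truncn // ler_pM2r ?invr_gt0 //; lra.
move=> /level[u0 uK] /level[v0 vK] /(congr1 val).
rewrite /= !inordK // => uv.
have := truncn_itv u0; have := truncn_itv v0; rewrite uv -addn1 natrD.
move: (_%:R) => n; rewrite !ler_pdivlMr // !ltr_pdivrMr // mulrDl mul1r.
move=> /andP[? ?] /andP[? ?]; rewrite ler_norml; apply/andP; split; lra.
Qed.

Lemma lattice_in_unit_interval (R : realType) (M : nat) (r : R) :
  (0 < M)%N -> on_lattice M r -> 0 <= r <= 1 ->
  exists n : 'I_M.+1, r = n%:R / M%:R.
Proof.
move=> M0 [m ->]; have MR0 : 0 < M%:R :> R by rewrite ltr0n.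
rewrite ler_pdivlMr // ler_pdivrMr // mul0r mul1r.
case: m => [m|m] /andP[m0 mM]; last first.
  by move: m0; rewrite ler0z.
have mM' : (m < M.+1)%N by rewrite ltnS -(ler_nat R).
by exists (Ordinal mM').
Qed.

(** [M.+1 ^ d] is the number of lattice points in the cube.  The factor
    [1 + 2 L] in the constant accounts for the Hoelder constant [2 L] of a
    difference of two functions of the class. *)
Lemma holder_class_covering (R : realType) (d : nat) (beta L : R) :
  (1 <= d)%N -> 0 < beta -> 0 <= L ->
  exists B C : R, [/\ 0 <= B, 1 <= C & forall (M : nat) (eta delta : R),
    (0 < M)%N -> 0 < eta -> C * (eta + M%:R^-1 `^ beta) <= delta / 2 ->
    (covering_number (@holder_class R d beta L) delta <=
      (((Num.truncn (2 * B / eta)).+1 ^ (M.+1 ^ d))%:R)%:E)%E].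
Proof.
move=> d1 beta0 L0.
have [B B0 bounded] := holder_class_bounded _ _ _ _ d1 beta0 L0.
have [C C1 small] := small_of_lattice_small R d (strict_floor beta) _
  (holder_exponent_ge0 _ _ beta0).
exists B, (C * (1 + 2 * L)); split=> //; first by nra.
move=> M eta delta M0 eta0 fine.
pose point (p : {ffun 'I_d -> 'I_M.+1}) : 'rV[R]_d := \row_i ((p i)%:R / M%:R).
pose code f : {ffun {ffun 'I_d -> 'I_M.+1} -> 'I_(Num.truncn (2 * B / eta)).+1} :=
  [ffun p => inord (Num.truncn ((f (point p) + B) / eta))].
have := @covering_number_le_card R _ _ (@holder_class R d beta L) delta code.
rewrite !card_ffun !card_ord; apply=> f g Hf Hg codeE x.
apply: le_trans fine.
have eps0 : 0 < M%:R^-1 :> R by rewrite invr_gt0 ltr0n.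
have epsE : M%:R^-1 ^+ strict_floor beta *
    M%:R^-1 `^ (beta - (strict_floor beta)%:R) = M%:R^-1 `^ beta :> R.
  rewrite -powR_mulrn ?ltW // -powRD; first by congr (_ `^ _); ring.
  by rewrite (gt_eqF eps0) implybT.
have := small (L + L) eta M (fun y => f y - g y).
rewrite epsE => small_h.
apply: (@le_trans _ _ (C * (eta + (L + L) * M%:R^-1 `^ beta))); last first.
  have := powR_ge0 (M%:R^-1 : R) beta; move: (_ `^ _) => r r0.
  rewrite -mulrA ler_pM2l; last lra.
  have : 0 <= L * eta by rewrite mulr_ge0 // ltW.
  lra.
apply: small_h => //; first lra; first lra.
  by apply: holder_along_axesB; exact: holder_class_along_axes.
move=> y y_lat; have [y_cube|y_out] := pselect (unit_cube y); last first.
  have [f0 _ _] := Hf; have [g0 _ _] := Hg.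
  by rewrite f0 // g0 // subrr normr0 ltW.
have [p pE] := choice (fun i =>
  lattice_in_unit_interval R M _ M0 (y_lat i) (y_cube i)).
have -> : y = point (finfun p) by apply/rowP => i; rewrite mxE ffunE pE.
apply: (@quantization_error R B) => //; try exact: bounded.
by move/ffunP: codeE => /(_ (finfun p)); rewrite !ffunE.
Qed.

Lemma metric_entropy_le (R : realType) (X : Type) (F G : set (X -> R))
    (delta : R) (n : nat) :
  F `<=` G -> (0 < n)%N -> (covering_number G delta <= (n%:R)%:E)%E ->
  (metric_entropy F delta <= (ln n%:R)%:E)%E.
Proof.
move=> FG n0 Gn; have n0R : 0 < n%:R :> R by rewrite ltr0n.
have Fn : (covering_number F delta <= (n%:R)%:E)%E.
  apply: le_trans Gn; apply: ereal_inf_le_tmp => _ [m [c Gc] <-].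
  by exists m => //; exists c; exact: subset_trans Gc.
have F0 : (0 <= covering_number F delta)%E.
  by apply: le_ereal_inf_tmp => _ [m _ <-]; rewrite lee_fin.
rewrite /metric_entropy -lne_EFin // lee_lne // in_itv /= leey andbT //.
Qed.

Theorem mainTheorem2 (R : realType) (d : nat) (beta L : R)
    (d_ge1 : (1 <= d)%N) (beta_gt0 : 0 < beta) (L_gt0 : 0 < L) :
  exists2 c : R, 0 < c & forall delta : R, 0 < delta -> delta <= 1 / 2 ->
    (metric_entropy (@holder_density R d beta L) delta <=
     (c * delta `^ (- (d%:R / beta)) * ln (1 / delta))%:E)%E.
Proof.
have [B [C [B0 C1 covering]]] :=
  holder_class_covering R d beta L d_ge1 beta_gt0 (ltW L_gt0).
have BC0 : 0 <= 8 * B * C by rewrite !mulr_ge0 //; lra.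
have ln2_gt0 : 0 < ln 2 :> R by rewrite ln_gt0 //; lra.
have lnBC : 0 <= ln (8 * B * C + 1) by rewrite ln_ge0 //; lra.
have ratio_ge0 : 0 <= ln (8 * B * C + 1) / ln 2 by rewrite divr_ge0 // ltW.
exists (3 ^+ d * (4 * C) `^ (d%:R / beta) * (ln (8 * B * C + 1) / ln 2 + 1)).
  by rewrite !mulr_gt0 ?exprn_gt0 ?powR_gt0 //; lra.
move=> delta delta0 delta_le.
(* [e] is both the rounding precision and an upper bound for [M ^ (- beta)], so
   that [C * (e + e) = delta / 2]. *)
pose e := delta / (4 * C).
have e0 : 0 < e by rewrite divr_gt0 //; lra.
have e1 : e <= 1 by rewrite ler_pdivrMr; lra.
pose X := e `^ (- beta^-1).
have XV : X^-1 = e `^ beta^-1 by rewrite /X powRN invrK.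
have X0 : 0 < X by rewrite powR_gt0.
have X1 : 1 <= X.
  rewrite -invf_le1 // XV.
  apply: (@le_trans _ _ (1 `^ beta^-1)); last by rewrite powR1.
  by apply: ge0_ler_powR; rewrite ?nnegrE ?invr_ge0 // ltW.
pose M := (Num.truncn X).+1.
have /andP[M_le M_gt] := truncn_itv (ltW X0).
have M_small : M%:R^-1 `^ beta <= e.
  have -> : e = X^-1 `^ beta.
    by rewrite XV -powRrM mulVf ?gt_eqF // powRr1 // ltW.
  apply: ge0_ler_powR; rewrite ?nnegrE ?invr_ge0 ?(ltW X0) ?(ltW beta_gt0) //.
  by rewrite lef_pV2 ?posrE ?ltr0n // ltW.
have fine : C * (e + M%:R^-1 `^ beta) <= delta / 2.
  have -> : delta / 2 = C * (e + e) by rewrite /e; field; lra.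
  by rewrite ler_pM2l; lra.
have count_gt0 : (0 < (Num.truncn (2 * B / e)).+1 ^ (M.+1 ^ d))%N.
  by rewrite expn_gt0.
apply: (le_trans (metric_entropy_le _ _ (@holder_density R d beta L) _ _ _ _
  count_gt0 (covering M e delta isT e0 fine))); first by move=> f [].
rewrite lee_fin natrX lnXn ?ltr0n // -[leLHS]mulr_natl natrX.
have points_le : (M.+1%:R : R) ^+ d <=
    3 ^+ d * (4 * C) `^ (d%:R / beta) * delta `^ (- (d%:R / beta)).
  have -> : 3 ^+ d * (4 * C) `^ (d%:R / beta) * delta `^ (- (d%:R / beta)) =
      (3 * X) ^+ d.
    rewrite exprMn -mulrA -[X ^+ d]powR_mulrn ?ltW // /X -powRrM.
    rewrite (_ : - beta^-1 * d%:R = - (d%:R / beta)); last ring.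
    rewrite !powRN /e [(delta / _) `^ _]powRM ?(ltW delta0) ?invr_ge0 //; last lra.
    have -> : (4 * C)^-1 `^ (d%:R / beta) = ((4 * C) `^ (d%:R / beta))^-1.
      by rewrite -powR_inv1 -?powRrM ?mulN1r ?powRN //; lra.
    by rewrite invfM invrK; ring.
  apply: lerXn2r; rewrite ?nnegrE ?mulr_ge0 // ?(ltW X0) //.
  (* [M.+1 <= X + 2 <= 3 X], as [1 <= X]. *)
  rewrite /M -2!addn1 !natrD; lra.
have levels_le : ln (Num.truncn (2 * B / e)).+1%:R <=
    (ln (8 * B * C + 1) / ln 2 + 1) * ln (1 / delta).
  (* [2 B / e = 8 B C / delta], and [1 <= 1 / delta] absorbs the extra level. *)
  have KE : (Num.truncn (2 * B / e)).+1%:R <= (8 * B * C + 1) * (1 / delta).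
    rewrite -addn1 natrD.
    have : (Num.truncn (2 * B / e))%:R <= 2 * B / e.
      by rewrite truncn_le (divr_ge0 _ (ltW e0)) // mulr_ge0.
    have -> : 2 * B / e = 8 * B * C * (1 / delta) by rewrite /e; field; lra.
    have : 1 <= 1 / delta by rewrite ler_pdivlMr; lra.
    lra.
  (* As [delta <= 1 / 2], the additive constant [ln (8 B C + 1)] is absorbed
     into a multiple of [ln (1 / delta)]. *)
  have ln2_le : ln 2 <= ln (1 / delta).
    by rewrite ler_ln ?posrE ?divr_gt0 // ler_pdivlMr; lra.
  have prod_gt0 : 0 < (8 * B * C + 1) * (1 / delta).
    by rewrite mulr_gt0 ?divr_gt0 //; lra.
  apply: (@le_trans _ _ (ln ((8 * B * C + 1) * (1 / delta)))).
    by rewrite ler_ln ?posrE ?ltr0n.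
  rewrite lnM ?posrE ?divr_gt0 //; last lra.
  rewrite [leRHS]mulrDl [1 * ln _]mul1r lerD2r.
  by rewrite [leRHS]mulrAC ler_pdivlMr //; exact: ler_wpM2l.
rewrite (_ : _ * ln (1 / delta) =
    3 ^+ d * (4 * C) `^ (d%:R / beta) * delta `^ (- (d%:R / beta)) *
    ((ln (8 * B * C + 1) / ln 2 + 1) * ln (1 / delta))); last ring.
apply: ler_pM => //.
by apply: ln_ge0; rewrite ler1n.
Qed.
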